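(* For every real Banach space $X$, $T_B(X)=T(X)$, where $$T_B(X)=\sup_{(x,y,\beta)\in\mathcal R_B(X)}\frac{2\|x\|^{1/2}\|\beta x+y\|^{1/2}}{r(x,y,\beta)},\qquad T(X)=\sup_{u,v\in S_X}\bigl(\|u+v\|\,\|u-v\|\bigr)^{1/2}.$$
   Context: $S_X=\{x\in X:\|x\|=1\}$. Birkhoff-James orthogonality: $x\perp_B y$ means $\|x+ty\|\ge\|x\|$ for all $t\in\mathbb{R}$. $\mathcal R_B(X)$ is the set of all triples $(x,y,\beta)\in X\times X\times\mathbb{R}$ such that $x\neq0$, $x\perp_B y$, and $0<\|(1+\beta)x+y\|=\|(1-\beta)x-y\|$. For $(x,y,\beta)\in\mathcal R_B(X)$, $r(x,y,\beta)=\|(1+\beta)x+y\|=\|(1-\beta)x-y\|$. *)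

(* Defs.v *)
From mathcomp Require Import all_boot all_order all_algebra.
From mathcomp Require Import all_classical all_reals all_analysis.

Set Implicit Arguments.
Unset Strict Implicit.
Unset Printing Implicit Defensive.

Import Order.TTheory GRing.Theory Num.Theory.
Import numFieldNormedType.Exports.

Local Open Scope classical_set_scope.
Local Open Scope ring_scope.

Definition unit_sphere (R : realType) (X : normedModType R) : set X :=
  [set x | `|x| = 1].

Definition birkhoff_orthogonal (R : realType) (X : normedModType R)
    (x y : X) : Prop :=
  forall t : R, `|x| <= `|x + t *: y|.

Definition RB (R : realType) (X : normedModType R) : set (X * X * R) :=
  [set p | let: (x, y, beta) := p in
    [/\ x != 0,
        birkhoff_orthogonal x y,
        0 < `|(1 + beta) *: x + y| &
        `|(1 + beta) *: x + y| = `|(1 - beta) *: x - y|]].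

Definition rB (R : realType) (X : normedModType R) (x y : X) (beta : R) : R :=
  `|(1 + beta) *: x + y|.

(* Both suprema are taken in the extended reals, so that neither relies on the
   junk value of [sup]; if X = 0 both index sets are empty and both are -oo. *)
Definition T_B (R : realType) (X : normedModType R) : \bar R :=
  ereal_sup [set (2 * Num.sqrt `|p.1.1| * Num.sqrt `|p.2 *: p.1.1 + p.1.2|
                  / rB p.1.1 p.1.2 p.2)%:E | p in @RB R X].

Definition T_const (R : realType) (X : normedModType R) : \bar R :=
  ereal_sup [set (Num.sqrt (`|p.1 + p.2| * `|p.1 - p.2|))%:E
            | p in @unit_sphere R X `*` @unit_sphere R X].

(* Main.v *)
Require Import Defs.
From mathcomp Require Import all_boot all_order all_algebra.
From mathcomp Require Import all_classical all_reals all_analysis.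
From mathcomp Require Import ring lra.

(** The substitution x = (u + v)/2, beta x + y = (u - v)/2 turns the triples
    of [RB] with r = 1 into pairs of unit vectors, and matches the two
    expressions whose suprema are taken; triples with any other r are reduced
    to this case by homogeneity.  Conversely, beta is recovered from x and
    w = (u - v)/2 as the value at w of a norming functional of x divided by
    |x|, which makes x Birkhoff-James orthogonal to y = w - beta x.  The pairs
    with u + v = 0 contribute only the value 0. *)

Set Implicit Arguments.
Unset Strict Implicit.
Unset Printing Implicit Defensive.

Import Order.TTheory GRing.Theory Num.Theory.
Import numFieldNormedType.Exports.

Local Open Scope classical_set_scope.
Local Open Scope ring_scope.

(* The Hahn-Banach step in the plane spanned by x and w: [c] is the largest
   value at w of a functional of norm 1 that takes the value |x| at x. *)
Lemma exists_birkhoff_orthogonal (R : realType) (X : normedModType R)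
    (x w : X) : x != 0 -> exists beta : R, birkhoff_orthogonal x (w - beta *: x).
Proof.
move=> x0; have nx : 0 < `|x| by rewrite normr_gt0.
(* A functional of norm 1 with value [|x|] at [x] takes at [w] a value at most each element of [E],
   and at least each [b * |x| - |b *: x - w|]. *)
pose E := range (fun a : R => `|a *: x + w| - a * `|x|).
have lbE b : lbound E (b * `|x| - `|b *: x - w|).
  move=> _ [a _ <-].
  have := ler_normD (a *: x + w) (b *: x - w).
  rewrite addrACA subrr addr0 -scalerDl normrZ.
  have : (a + b) * `|x| <= `|a + b| * `|x| by rewrite ler_wpM2r ?ler_norm ?ltW.
  by lra.
have E0 : E !=set0 by exists (`|0 *: x + w| - 0 * `|x|); exists 0.
pose c := inf E.
have cle a : c <= `|a *: x + w| - a * `|x|.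
  by apply: ge_inf; [exists (0 * `|x| - `|0 *: x - w|) | exists a].
have cge b : b * `|x| - `|b *: x - w| <= c by apply: lb_le_inf.
exists (c / `|x|) => t; set beta := c / `|x|.
have bx : beta * `|x| = c by rewrite divfK ?gt_eqF.
(* Factoring out [|t|] reduces the claim to [cge] for [t < 0] and to [cle] for [t > 0]. *)
have [t0|t0|->] := ltgtP t 0; last by rewrite scale0r addr0.
- have -> : x + t *: (w - beta *: x) = (- t) *: (((- t)^-1 + beta) *: x - w).
    rewrite [RHS]scalerBr scalerA mulrDr divff ?oppr_eq0 ?lt_eqF//.
    rewrite scalerDl scale1r mulNr !scaleNr opprK -scalerA.
    by rewrite scalerBr -addrA [- _ + _]addrC.
  rewrite normrZ gtr0_norm ?oppr_gt0// -ler_pdivrMl ?oppr_gt0//.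
  by have := cge ((- t)^-1 + beta); rewrite mulrDl bx; lra.
- have -> : x + t *: (w - beta *: x) = t *: ((t^-1 - beta) *: x + w).
    rewrite [RHS]scalerDr scalerA mulrBr divff ?gt_eqF//.
    by rewrite scalerBl scale1r -scalerA scalerBr -addrA [- _ + _]addrC.
  rewrite normrZ gtr0_norm// -ler_pdivrMl//.
  by have := cle (t^-1 - beta); rewrite mulrBl bx; lra.
Qed.

Lemma T_B_le_T (R : realType) (X : normedModType R) :
  (@T_B R X <= @T_const R X)%E.
Proof.
apply: ge_ereal_sup => _ [[[x y] beta] /= [x0 xy r0 rE] <-].
rewrite /rB; set r := `|_ + y| in r0 rE *.
have rV0 : 0 <= r^-1 by rewrite invr_ge0 ltW.
apply: ereal_sup_ubound.
(* Both vectors have norm [r] before scaling; the scaled pair has sum [2x/r] and difference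
   [2(beta x + y)/r]. *)
exists (r^-1 *: ((1 + beta) *: x + y), r^-1 *: ((1 - beta) *: x - y)).
  by split; rewrite /unit_sphere /= normrZ ger0_norm// -?rE mulVf ?gt_eqF.
congr (_%:E); rewrite /= -scalerDr -scalerBr.
have -> : (1 + beta) *: x + y + ((1 - beta) *: x - y) = 2 *: x.
  by rewrite addrACA subrr addr0 -scalerDl; congr (_ *: _); ring.
have -> : (1 + beta) *: x + y - ((1 - beta) *: x - y) = 2 *: (beta *: x + y).
  rewrite [RHS]scalerDr scalerA [2 *: y]scaler_nat mulr2n.
  rewrite opprB [y - _]addrC addrACA -scalerBl.
  by congr (_ *: _ + _); ring.
rewrite !normrZ (ger0_norm rV0) ger0_norm//.
rewrite (_ : _ * _ = (2 * r^-1) ^+ 2 * (`|x| * `|beta *: x + y|)); last by ring.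
rewrite sqrtrM ?sqr_ge0// sqrtr_sqr ger0_norm ?mulr_ge0// sqrtrM//.
by ring.
Qed.

Lemma T_le_T_B (R : realType) (X : normedModType R) :
  (@T_const R X <= @T_B R X)%E.
Proof.
apply: ge_ereal_sup => _ [[u v] /= [u1 v1] <-].
rewrite /unit_sphere /= in u1 v1.
apply: ereal_sup_ubound.
have [uv0|uv0] := eqVneq (u + v) 0.
  (* Here [(u + v)/2] vanishes and cannot serve as [x]; this triple has [beta x + y = 0], hence
     value 0. *)
  exists (u, 0, 0) => /=.
    split; rewrite ?addr0 ?subr0 ?scale1r ?u1 //.
    - by rewrite -normr_gt0 u1.
    - by move=> t; rewrite scaler0 addr0.
  by rewrite uv0 scale0r addr0 normr0 mul0r sqrtr0 mulr0 mul0r.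
pose x := 2^-1 *: (u + v); pose w := 2^-1 *: (u - v).
have xwu : x + w = u.
  rewrite -scalerDr addrACA subrr addr0 -mulr2n -[u *+ 2]scaler_nat.
  by rewrite scalerA mulVf ?scale1r.
have xwv : x - w = v.
  rewrite -scalerBr opprB [v - u]addrC addrACA subrr add0r -mulr2n.
  by rewrite -[v *+ 2]scaler_nat scalerA mulVf ?scale1r.
have x0 : x != 0 by rewrite scaler_eq0 negb_or uv0 invr_eq0 pnatr_eq0.
have [beta xy] := exists_birkhoff_orthogonal w x0.
have plusE : (1 + beta) *: x + (w - beta *: x) = u.
  by rewrite scalerDl scale1r addrACA subrr addr0.
have minusE : (1 - beta) *: x - (w - beta *: x) = v.
  by rewrite scalerBl scale1r opprB addrA subrK.
exists (x, w - beta *: x, beta) => /=.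
  by split; rewrite ?plusE ?minusE ?u1 ?v1.
rewrite /rB plusE u1 divr1 addrC subrK !normrZ ger0_norm ?invr_ge0//.
rewrite !sqrtrM ?invr_ge0//; congr (_%:E).
(* The halves in [x] and [w] each leave a root of 1/2, and together they cancel the factor 2 of
   [T_B]. *)
have s2 : Num.sqrt 2^-1 * Num.sqrt 2^-1 = 2^-1 :> R.
  by rewrite -expr2 sqr_sqrtr ?invr_ge0.
transitivity (2 * (Num.sqrt 2^-1 * Num.sqrt 2^-1) *
    (Num.sqrt `|u + v| * Num.sqrt `|u - v|)); first by ring.
by rewrite s2 divff ?mul1r.
Qed.

Theorem theorem4p11 (R : realType) (X : completeNormedModType R) :
  @T_B R X = @T_const R X.
Proof. by apply/le_anti; rewrite T_B_le_T T_le_T_B. Qed.
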